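(* Let $\mathcal M=(\mathcal C,\mathsf T)$ be a CBPV model for which $\mathsf T$ is lax idempotent. For every source-language type $\tau$, object $W$ of $\mathcal C$, and pair of morphisms $f^v:W\to T\mathcal V[\![\tau]\!]$, $f^n:W\to U_{\mathsf T}\mathcal N[\![\tau]\!]$, we have the equivalences $$\phi_\tau\circ f^v\sqsubseteq f^n\quad\Leftrightarrow\quad f^v\ \mathcal R[\![\tau]\!]_W\ f^n\quad\Leftrightarrow\quad f^v\sqsubseteq\psi_\tau\circ f^n.$$
   Context: **Order-enriched notions.** A Poset-category is a category $\mathcal C$ with a partial order $\sqsubseteq$ on each hom-set such that composition is monotone. It is cartesian if it has a terminal object $1$ (unique maps $\langle\rangle_X:X\to 1$) and binary products (projections $\pi_i$) with monotone pairing $\langle-,-\rangle$; $\mathrm{assoc}:(X_1\times X_2)\times X_3\to X_1\times(X_2\times X_3)$ is the canonical isomorphism. It is cartesian closed if moreover it has exponentials $X\Rightarrow Y$ with monotone currying $\Lambda:\mathcal C(W\times X,Y)\to\mathcal C(W,X\Rightarrow Y)$; $\mathrm{ev}=\Lambda^{-1}\mathrm{id}:(X\Rightarrow Y)\times X\to Y$. Binary coproducts are required to have monotone copairing. A strong Poset-monad $\mathsf T$ on a cartesian $\mathcal C$ consists of objects $TX$, morphisms $\eta_X:X\to TX$, and monotone functions $(-)^{\dagger(W\times\square)}:\mathcal C(W\times X,TY)\to\mathcal C(W\times TX,TY)$ such that: $f^{\dagger(W\times\square)}\circ(w\times \mathrm{id})=(f\circ(w\times\mathrm{id}))^{\dagger(W'\times\square)}$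 for $w:W'\to W$; $f^{\dagger(W\times\square)}\circ(\mathrm{id}_W\times\eta_X)=f$; $(\eta_X\circ\pi_2)^{\dagger(1\times\square)}=\pi_2$; and $(g^{\dagger(W'\times\square)}\circ(\mathrm{id}_{W'}\times f)\circ\mathrm{assoc})^{\dagger((W'\times W)\times\square)}=g^{\dagger(W'\times\square)}\circ(\mathrm{id}_{W'}\times f^{\dagger(W\times\square)})\circ\mathrm{assoc}$ for $f:W\times X\to TY$, $g:W'\times Y\to TZ$. A $\mathsf T$-algebra $\mathsf Z$ is an object $Z=U_{\mathsf T}\mathsf Z$ (the carrier) with monotone functions $(-)^{\ddagger(W\times\square)}:\mathcal C(W\times X,Z)\to\mathcal C(W\times TX,Z)$ satisfying the same naturality in $W$, the left unit law $f^{\ddagger(W\times\square)}\circ(\mathrm{id}_W\times\eta_X)=f$, and associativity $(g^{\ddagger(W'\times\square)}\circ(\mathrm{id}_{W'}\times f)\circ\mathrm{assoc})^{\ddagger((W'\times W)\times\square)}=g^{\ddagger(W'\times\square)}\circ(\mathrm{id}_{W'}\times f^{\dagger(W\times\square)})\circ\mathrm{assoc}$ for $f:W\times X\to TY$, $g:W'\times Y\to Z$. Derived notation: for $f:X\to TY$, $f^\dagger:TX\to TY$ is the case $W=1$ (using $1\times X\cong X$); $Tf=(\eta_Y\circ f)^\dagger$ for $f:X\to Y$; $f^{\dagger(\square\times W)}=(f\circ\langle\pi_2,\pi_1\rangle)^{\dagger(W\times\square)}\circ\langle\pi_2,\pi_1\rangle$ for $f:X\times W\to TY$; $\mathrm{seq}^{L}_{X_1,X_2}=(\eta_{X_1\times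 X_2}^{\dagger(X_1\times\square)})^{\dagger(\square\times TX_2)}:TX_1\times TX_2\to T(X_1\times X_2)$; $\langle\!\langle f_1,f_2\rangle\!\rangle=\mathrm{seq}^{L}\circ\langle f_1,f_2\rangle:W\to T(X_1\times X_2)$ for $f_i:W\to TX_i$. $\mathsf T$ is lax idempotent if $T\eta_Y\sqsubseteq\eta_{TY}$ for every object $Y$. Algebra constructions: the free algebra $F_{\mathsf T}X$ has carrier $TX$ and extension $(-)^{\dagger(W\times\square)}$; the product $\mathsf Z_1\times\mathsf Z_2$ has carrier $Z_1\times Z_2$ and componentwise extension; the power $Y\Rightarrow\mathsf Z$ has carrier $Y\Rightarrow Z$ and $f^{\ddagger(W\times\square)}=\Lambda\big((\Lambda^{-1}f\circ\beta_{W,Y,X})^{\ddagger((W\times Y)\times\square)}\circ\beta_{W,TX,Y}\big)$, where $\beta_{X_1,X_2,X_3}:(X_1\times X_2)\times X_3\to(X_1\times X_3)\times X_2$ is the canonical isomorphism. A CBPV model $\mathcal M=(\mathcal C,\mathsf T)$ is a cartesian closed Poset-category $\mathcal C$ admitting the coproduct $2=1+1$, with a strong Poset-monad $\mathsf T$ on $\mathcal C$. **Types.** Source-language types are $\tau::=\mathbf{unit}\mid\mathbf{bool}\mid\tau_1\times\tau_2\mid\tau\to\tau'$. Call-by-value interpretation (objects): $\mathcal V[\![\mathbf{unit}]\!]=1$, $\mathcal V[\![\mathbf{bool}]\!]=2$, $\mathcal V[\![\tau_1\times\tau_2]\!]=\mathcal V[\![\tau_1]\!]\times\mathcal V[\![\tau_2]\!]$,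 $\mathcal V[\![\tau\to\tau']\!]=\mathcal V[\![\tau]\!]\Rightarrow T\mathcal V[\![\tau']\!]$. Call-by-name interpretation ($\mathsf T$-algebras): $\mathcal N[\![\mathbf{unit}]\!]=F_{\mathsf T}1$, $\mathcal N[\![\mathbf{bool}]\!]=F_{\mathsf T}2$, $\mathcal N[\![\tau_1\times\tau_2]\!]=\mathcal N[\![\tau_1]\!]\times\mathcal N[\![\tau_2]\!]$, $\mathcal N[\![\tau\to\tau']\!]=U_{\mathsf T}\mathcal N[\![\tau]\!]\Rightarrow\mathcal N[\![\tau']\!]$. **The relations.** For $f^v:W\to T\mathcal V[\![\tau]\!]$ and $f^n:W\to U_{\mathsf T}\mathcal N[\![\tau]\!]$, define $f^v\,\mathcal R[\![\tau]\!]_W\,f^n$ by induction on $\tau$: for $\tau\in\{\mathbf{unit},\mathbf{bool}\}$, iff $f^v\sqsubseteq f^n$; for $\tau_1\times\tau_2$, iff $(T\pi_i\circ f^v)\,\mathcal R[\![\tau_i]\!]_W\,(\pi_i\circ f^n)$ for $i=1,2$; for $\tau\to\tau'$, iff for all $W'$, $w:W'\to W$, $g^v:W'\to T\mathcal V[\![\tau]\!]$, $g^n:W'\to U_{\mathsf T}\mathcal N[\![\tau]\!]$, $g^v\,\mathcal R[\![\tau]\!]_{W'}\,g^n$ implies $(\mathrm{ev}^\dagger\circ\langle\!\langle f^v\circ w,g^v\rangle\!\rangle)\,\mathcal R[\![\tau']\!]_{W'}\,(\mathrm{ev}\circ\langle f^n\circ w,g^n\rangle)$. **The maps.** $\phi_\tau:T\mathcal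 V[\![\tau]\!]\to U_{\mathsf T}\mathcal N[\![\tau]\!]$ and $\psi_\tau:U_{\mathsf T}\mathcal N[\![\tau]\!]\to T\mathcal V[\![\tau]\!]$ are defined by mutual induction: $\phi_{\mathbf{unit}}=\psi_{\mathbf{unit}}=\mathrm{id}_{T1}$; $\phi_{\mathbf{bool}}=\psi_{\mathbf{bool}}=\mathrm{id}_{T2}$; $\phi_{\tau_1\times\tau_2}=\langle\phi_{\tau_1}\circ T\pi_1,\phi_{\tau_2}\circ T\pi_2\rangle$; $\psi_{\tau_1\times\tau_2}=\langle\!\langle\psi_{\tau_1}\circ\pi_1,\psi_{\tau_2}\circ\pi_2\rangle\!\rangle$; $\phi_{\tau\to\tau'}=\Lambda(\phi_{\tau'}\circ\mathrm{ev}^\dagger\circ\langle\!\langle\pi_1,\psi_\tau\circ\pi_2\rangle\!\rangle)$; $\psi_{\tau\to\tau'}=\eta\circ\Lambda(\psi_{\tau'}\circ\mathrm{ev}\circ(\mathrm{id}\times(\phi_\tau\circ\eta)))$. *)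

(* Defs.v *)
From Stdlib Require Import Relation_Definitions ssreflect.

Set Implicit Arguments.
Unset Strict Implicit.
Unset Printing Implicit Defensive.

Declare Scope cat_scope.
Delimit Scope cat_scope with cat.
Local Open Scope cat_scope.

Reserved Notation "X ~> Y" (at level 70, no associativity).
Reserved Notation "f ⊑ g" (at level 70, no associativity).
Reserved Notation "g ∘ f" (at level 40, left associativity).
Reserved Notation "X × Y" (at level 38, left associativity).
Reserved Notation "f ⊗ g" (at level 38, left associativity).
Reserved Notation "X ⇒ Y" (at level 39, right associativity).
Reserved Notation "⟨ f , g ⟩" (at level 0, f at level 60, g at level 60).
Reserved Notation "⟪ f , g ⟫" (at level 0, f at level 60, g at level 60).

Record poset_category := PosetCategory {
  ob :> Type;
  hom : ob -> ob -> Type;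
  hle : forall X Y : ob, relation (hom X Y);
  idm : forall X : ob, hom X X;
  comp : forall X Y Z : ob, hom Y Z -> hom X Y -> hom X Z;
  hle_order : forall X Y : ob, order (hom X Y) (@hle X Y);
  comp_idl : forall (X Y : ob) (f : hom X Y), comp (idm Y) f = f;
  comp_idr : forall (X Y : ob) (f : hom X Y), comp f (idm X) = f;
  comp_assoc : forall (X Y Z V : ob) (h : hom Z V) (g : hom Y Z) (f : hom X Y),
    comp (comp h g) f = comp h (comp g f);
  comp_mono : forall (X Y Z : ob) (g g' : hom Y Z) (f f' : hom X Y),
    hle g g' -> hle f f' -> hle (comp g f) (comp g' f')
}.

Arguments hom {C} X Y : rename.
Arguments hle {C X Y} f g : rename.
Arguments idm {C} X : rename.
Arguments comp {C X Y Z} g f : rename.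

Notation "X ~> Y" := (hom X Y) : cat_scope.
Notation "f ⊑ g" := (hle f g) : cat_scope.
Notation "g ∘ f" := (comp g f) : cat_scope.

Record coproduct (C : poset_category) (A B : C) := Coproduct {
  cop_ob : C;
  cop_inl : A ~> cop_ob;
  cop_inr : B ~> cop_ob;
  copair : forall X : C, (A ~> X) -> (B ~> X) -> (cop_ob ~> X);
  copair_inl : forall (X : C) (f : A ~> X) (g : B ~> X), copair f g ∘ cop_inl = f;
  copair_inr : forall (X : C) (f : A ~> X) (g : B ~> X), copair f g ∘ cop_inr = g;
  copair_eta : forall (X : C) (h : cop_ob ~> X),
    copair (h ∘ cop_inl) (h ∘ cop_inr) = h;
  copair_mono : forall (X : C) (f f' : A ~> X) (g g' : B ~> X),
    f ⊑ f' -> g ⊑ g' -> copair f g ⊑ copair f' g'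
}.

Record cartesian_category := CartesianCategory {
  cart_base :> poset_category;
  one : cart_base;
  bang : forall X : cart_base, X ~> one;
  bang_unique : forall (X : cart_base) (f : X ~> one), f = bang X;
  prod : cart_base -> cart_base -> cart_base;
  pi1 : forall X Y : cart_base, prod X Y ~> X;
  pi2 : forall X Y : cart_base, prod X Y ~> Y;
  pair : forall W X Y : cart_base, (W ~> X) -> (W ~> Y) -> (W ~> prod X Y);
  pi1_pair : forall (W X Y : cart_base) (f : W ~> X) (g : W ~> Y),
    pi1 X Y ∘ pair f g = f;
  pi2_pair : forall (W X Y : cart_base) (f : W ~> X) (g : W ~> Y),
    pi2 X Y ∘ pair f g = g;
  pair_eta : forall (W X Y : cart_base) (h : W ~> prod X Y),
    pair (pi1 X Y ∘ h) (pi2 X Y ∘ h) = h;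
  pair_mono : forall (W X Y : cart_base) (f f' : W ~> X) (g g' : W ~> Y),
    f ⊑ f' -> g ⊑ g' -> pair f g ⊑ pair f' g'
}.

Arguments one {C} : rename.
Arguments bang {C} X : rename.
Arguments prod {C} X Y : rename.
Arguments pi1 {C X Y} : rename.
Arguments pi2 {C X Y} : rename.
Arguments pair {C W X Y} f g : rename.

Notation "X × Y" := (prod X Y) : cat_scope.
Notation "⟨ f , g ⟩" := (pair f g) : cat_scope.

Definition prod_mor (C : cartesian_category) (X X' Y Y' : C)
  (f : X ~> X') (g : Y ~> Y') : X × Y ~> X' × Y' := ⟨f ∘ pi1, g ∘ pi2⟩.
Notation "f ⊗ g" := (prod_mor f g) : cat_scope.

Definition assoc {C : cartesian_category} {X1 X2 X3 : C} :
  (X1 × X2) × X3 ~> X1 × (X2 × X3) := ⟨pi1 ∘ pi1, ⟨pi2 ∘ pi1, pi2⟩⟩.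

Definition beta {C : cartesian_category} (X1 X2 X3 : C) :
  (X1 × X2) × X3 ~> (X1 × X3) × X2 := ⟨⟨pi1 ∘ pi1, pi2⟩, pi2 ∘ pi1⟩.

Definition swap {C : cartesian_category} {X Y : C} : X × Y ~> Y × X := ⟨pi2, pi1⟩.

(* [curry] is an isomorphism of posets: monotonicity of its inverse follows from
   that of composition and pairing, see [uncurry_mono] below. *)
Record cartesian_closed_category := CartesianClosedCategory {
  ccc_base :> cartesian_category;
  expo : ccc_base -> ccc_base -> ccc_base;
  curry : forall W X Y : ccc_base, (W × X ~> Y) -> (W ~> expo X Y);
  uncurry : forall W X Y : ccc_base, (W ~> expo X Y) -> (W × X ~> Y);
  curryK : forall (W X Y : ccc_base) (f : W × X ~> Y), uncurry (curry f) = f;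
  uncurryK : forall (W X Y : ccc_base) (g : W ~> expo X Y), curry (uncurry g) = g;
  curry_nat : forall (W W' X Y : ccc_base) (f : W × X ~> Y) (w : W' ~> W),
    curry f ∘ w = curry (f ∘ (w ⊗ idm X));
  curry_mono : forall (W X Y : ccc_base) (f f' : W × X ~> Y),
    f ⊑ f' -> curry f ⊑ curry f'
}.

Arguments expo {C} X Y : rename.
Arguments curry {C W X Y} f : rename.
Arguments uncurry {C W X Y} g : rename.

Notation "X ⇒ Y" := (expo X Y) : cat_scope.

Definition ev {C : cartesian_closed_category} {X Y : C} : (X ⇒ Y) × X ~> Y :=
  uncurry (idm (X ⇒ Y)).

Record strong_monad (C : cartesian_category) := StrongMonad {
  T_ob :> C -> C;
  T_eta : forall X : C, X ~> T_ob X;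
  T_ext : forall W X Y : C, (W × X ~> T_ob Y) -> (W × T_ob X ~> T_ob Y);
  T_ext_mono : forall (W X Y : C) (f f' : W × X ~> T_ob Y),
    f ⊑ f' -> T_ext f ⊑ T_ext f';
  T_ext_nat : forall (W W' X Y : C) (f : W × X ~> T_ob Y) (w : W' ~> W),
    T_ext f ∘ (w ⊗ idm (T_ob X)) = T_ext (f ∘ (w ⊗ idm X));
  T_ext_unitl : forall (W X Y : C) (f : W × X ~> T_ob Y),
    T_ext f ∘ (idm W ⊗ T_eta X) = f;
  T_ext_unitr : forall X : C,
    T_ext (T_eta X ∘ (pi2 : one × X ~> X)) = pi2;
  T_ext_assoc : forall (W W' X Y Z : C)
    (f : W × X ~> T_ob Y) (g : W' × Y ~> T_ob Z),
    T_ext (T_ext g ∘ (idm W' ⊗ f) ∘ assoc) =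
    T_ext g ∘ (idm W' ⊗ T_ext f) ∘ assoc
}.

Arguments T_eta {C T} X : rename.
Arguments T_ext {C T W X Y} f : rename.

Section DerivedMonadOperations.

Context {C : cartesian_category} {T : strong_monad C}.

(* The case W = 1 of [T_ext], transported along the isomorphism 1 × X ≅ X. *)
Definition dagger {X Y : C} (f : X ~> T Y) : T X ~> T Y :=
  T_ext (f ∘ (pi2 : one × X ~> X)) ∘ ⟨bang (T X), idm (T X)⟩.

Definition T_map {X Y : C} (f : X ~> Y) : T X ~> T Y := dagger (T_eta Y ∘ f).

Definition T_ext_right {W X Y : C} (f : X × W ~> T Y) : T X × W ~> T Y :=
  T_ext (f ∘ swap) ∘ swap.

Definition seqL {X1 X2 : C} : T X1 × T X2 ~> T (X1 × X2) :=
  T_ext_right (T_ext (T_eta (X1 × X2))).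

Definition seq_pair {W X1 X2 : C} (f1 : W ~> T X1) (f2 : W ~> T X2) :
  W ~> T (X1 × X2) := seqL ∘ ⟨f1, f2⟩.

End DerivedMonadOperations.

Notation "⟪ f , g ⟫" := (seq_pair f g) : cat_scope.

Definition lax_idempotent (C : cartesian_category) (T : strong_monad C) : Prop :=
  forall Y : C, T_map (T_eta Y) ⊑ (T_eta (T Y) : T Y ~> T (T Y)).

Record algebra (C : cartesian_category) (T : strong_monad C) := Algebra {
  carrier : C;
  alg_ext : forall W X : C, (W × X ~> carrier) -> (W × T X ~> carrier);
  alg_ext_mono : forall (W X : C) (f f' : W × X ~> carrier),
    f ⊑ f' -> alg_ext f ⊑ alg_ext f';
  alg_ext_nat : forall (W W' X : C) (f : W × X ~> carrier) (w : W' ~> W),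
    alg_ext f ∘ (w ⊗ idm (T X)) = alg_ext (f ∘ (w ⊗ idm X));
  alg_ext_unitl : forall (W X : C) (f : W × X ~> carrier),
    alg_ext f ∘ (idm W ⊗ T_eta X) = f;
  alg_ext_assoc : forall (W W' X Y : C)
    (f : W × X ~> T Y) (g : W' × Y ~> carrier),
    alg_ext (alg_ext g ∘ (idm W' ⊗ f) ∘ assoc) =
    alg_ext g ∘ (idm W' ⊗ T_ext f) ∘ assoc
}.

Arguments carrier {C T} Z : rename.
Arguments alg_ext {C T} Z {W X} f : rename.

Definition free_algebra (C : cartesian_category) (T : strong_monad C) (X : C) :
  algebra T :=
  {| carrier := T X;
     alg_ext := fun W Y f => T_ext f;
     alg_ext_mono := fun W Y => @T_ext_mono C T W Y X;
     alg_ext_nat := fun W W' Y => @T_ext_nat C T W W' Y X;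
     alg_ext_unitl := fun W Y => @T_ext_unitl C T W Y X;
     alg_ext_assoc := fun W W' V Y => @T_ext_assoc C T W W' V Y X |}.

Section CartesianLemmas.

Context {C : cartesian_category}.

Lemma pair_comp (V W X Y : C) (f : W ~> X) (g : W ~> Y) (h : V ~> W) :
  ⟨f, g⟩ ∘ h = ⟨f ∘ h, g ∘ h⟩.
Proof. by rewrite -(pair_eta (⟨f, g⟩ ∘ h)) -!comp_assoc pi1_pair pi2_pair. Qed.

Lemma pi1_pair_comp (V W X Y : C) (f : W ~> X) (g : W ~> Y) (h : V ~> W) :
  pi1 ∘ (⟨f, g⟩ ∘ h) = f ∘ h.
Proof. by rewrite -comp_assoc pi1_pair. Qed.

Lemma pi2_pair_comp (V W X Y : C) (f : W ~> X) (g : W ~> Y) (h : V ~> W) :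
  pi2 ∘ (⟨f, g⟩ ∘ h) = g ∘ h.
Proof. by rewrite -comp_assoc pi2_pair. Qed.

Lemma pair_id (X Y : C) : ⟨pi1, pi2⟩ = idm (X × Y).
Proof. by rewrite -[RHS]pair_eta !comp_idr. Qed.

End CartesianLemmas.

Ltac cartesian := rewrite /prod_mor /assoc /beta /swap;
  repeat progress rewrite ?comp_assoc ?pair_comp ?pi1_pair ?pi2_pair ?pi1_pair_comp
    ?pi2_pair_comp ?comp_idl ?comp_idr ?pair_eta ?pair_id.

Section ProductAlgebra.

Context {C : cartesian_category} {T : strong_monad C} (Z1 Z2 : algebra T).

Definition prod_ext (W X : C) (f : W × X ~> carrier Z1 × carrier Z2) :
  W × T X ~> carrier Z1 × carrier Z2 :=
  ⟨alg_ext Z1 (pi1 ∘ f), alg_ext Z2 (pi2 ∘ f)⟩.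

Lemma prod_ext_mono (W X : C) (f f' : W × X ~> carrier Z1 × carrier Z2) :
  f ⊑ f' -> prod_ext f ⊑ prod_ext f'.
Proof.
move=> le_ff'; apply: pair_mono; apply: alg_ext_mono; apply: comp_mono => //;
  exact: (ord_refl _ _ (hle_order _ _)).
Qed.

Lemma prod_ext_nat (W W' X : C) (f : W × X ~> carrier Z1 × carrier Z2) (w : W' ~> W) :
  prod_ext f ∘ (w ⊗ idm (T X)) = prod_ext (f ∘ (w ⊗ idm X)).
Proof. by rewrite /prod_ext pair_comp !alg_ext_nat !comp_assoc. Qed.

Lemma prod_ext_unitl (W X : C) (f : W × X ~> carrier Z1 × carrier Z2) :
  prod_ext f ∘ (idm W ⊗ T_eta X) = f.
Proof. by rewrite /prod_ext pair_comp !alg_ext_unitl pair_eta. Qed.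

Lemma prod_ext_assoc (W W' X Y : C)
  (f : W × X ~> T Y) (g : W' × Y ~> carrier Z1 × carrier Z2) :
  prod_ext (prod_ext g ∘ (idm W' ⊗ f) ∘ assoc) =
  prod_ext g ∘ (idm W' ⊗ T_ext f) ∘ assoc.
Proof.
rewrite {1}/prod_ext -!(comp_assoc pi1) -!(comp_assoc pi2).
by rewrite /prod_ext pi1_pair pi2_pair !alg_ext_assoc !pair_comp.
Qed.

Definition prod_algebra : algebra T :=
  {| carrier := carrier Z1 × carrier Z2;
     alg_ext := prod_ext;
     alg_ext_mono := prod_ext_mono;
     alg_ext_nat := prod_ext_nat;
     alg_ext_unitl := prod_ext_unitl;
     alg_ext_assoc := prod_ext_assoc |}.

End ProductAlgebra.

Section PowerAlgebra.

Context {C : cartesian_closed_category} {T : strong_monad C}.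
Variables (P : C) (Z : algebra T).

Lemma uncurry_nat (W W' X Y : C) (g : W ~> X ⇒ Y) (w : W' ~> W) :
  uncurry (g ∘ w) = uncurry g ∘ (w ⊗ idm X).
Proof. by rewrite -{1}(uncurryK g) curry_nat curryK. Qed.

Lemma uncurryE (W X Y : C) (g : W ~> X ⇒ Y) : uncurry g = ev ∘ (g ⊗ idm X).
Proof. by rewrite /ev -uncurry_nat comp_idl. Qed.

Lemma uncurry_inj (W X Y : C) (g g' : W ~> X ⇒ Y) : uncurry g = uncurry g' -> g = g'.
Proof. by move=> e; rewrite -(uncurryK g) e uncurryK. Qed.

Lemma uncurry_mono (W X Y : C) (g g' : W ~> X ⇒ Y) :
  g ⊑ g' -> uncurry g ⊑ uncurry g'.
Proof.
move=> le_gg'; rewrite !uncurryE.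
have refl X' Y' (h : hom (C := C) X' Y') : h ⊑ h by exact: (ord_refl _ _ (hle_order _ _)).
by apply: comp_mono => //; apply: pair_mono => //; apply: comp_mono.
Qed.

Definition power_ext (W X : C) (f : W × X ~> P ⇒ carrier Z) :
  W × T X ~> P ⇒ carrier Z :=
  curry (alg_ext Z (uncurry f ∘ beta W P X) ∘ beta W (T X) P).

Lemma power_ext_mono (W X : C) (f f' : W × X ~> P ⇒ carrier Z) :
  f ⊑ f' -> power_ext f ⊑ power_ext f'.
Proof.
move=> le_ff'; apply: curry_mono.
have refl X' Y' (h : hom (C := C) X' Y') : h ⊑ h by exact: (ord_refl _ _ (hle_order _ _)).
apply: comp_mono => //; apply: alg_ext_mono; apply: comp_mono => //.
exact: uncurry_mono.
Qed.

Lemma power_ext_nat (W W' X : C) (f : W × X ~> P ⇒ carrier Z) (w : W' ~> W) :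
  power_ext f ∘ (w ⊗ idm (T X)) = power_ext (f ∘ (w ⊗ idm X)).
Proof.
rewrite /power_ext curry_nat uncurry_nat; congr curry.
have -> : uncurry f ∘ (w ⊗ idm X ⊗ idm P) ∘ beta W' P X =
          uncurry f ∘ beta W P X ∘ (w ⊗ idm P ⊗ idm X) by cartesian.
by rewrite -alg_ext_nat; cartesian.
Qed.

Lemma power_ext_unitl (W X : C) (f : W × X ~> P ⇒ carrier Z) :
  power_ext f ∘ (idm W ⊗ T_eta X) = f.
Proof.
rewrite /power_ext curry_nat -[RHS]uncurryK; congr curry.
have -> : alg_ext Z (uncurry f ∘ beta W P X) ∘ beta W (T X) P
            ∘ (idm W ⊗ T_eta X ⊗ idm P) =
          alg_ext Z (uncurry f ∘ beta W P X) ∘ (idm (W × P) ⊗ T_eta X) ∘ beta W X P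
  by cartesian.
by rewrite alg_ext_unitl; cartesian.
Qed.

Lemma power_ext_assoc (W W' X Y : C)
  (f : W × X ~> T Y) (g : W' × Y ~> P ⇒ carrier Z) :
  power_ext (power_ext g ∘ (idm W' ⊗ f) ∘ assoc) =
  power_ext g ∘ (idm W' ⊗ T_ext f) ∘ assoc.
Proof.
apply: uncurry_inj; rewrite {1}/power_ext curryK !uncurry_nat {1 2}/power_ext !curryK.
set A := uncurry g ∘ _.
have -> : alg_ext Z A ∘ beta W' (T Y) P ∘ (idm W' ⊗ f ⊗ idm P) ∘ (assoc ⊗ idm P)
            ∘ beta (W' × W) P X =
          alg_ext Z A ∘ (idm (W' × P) ⊗ f) ∘ assoc ∘ (beta W' W P ⊗ idm X)
  by cartesian.
by rewrite -alg_ext_nat alg_ext_assoc; cartesian.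
Qed.

Definition power_algebra : algebra T :=
  {| carrier := P ⇒ carrier Z;
     alg_ext := power_ext;
     alg_ext_mono := power_ext_mono;
     alg_ext_nat := power_ext_nat;
     alg_ext_unitl := power_ext_unitl;
     alg_ext_assoc := power_ext_assoc |}.

End PowerAlgebra.

Record cbpv_model := CBPVModel {
  model_cat :> cartesian_closed_category;
  two : coproduct (one : model_cat) (one : model_cat);
  model_monad : strong_monad model_cat
}.

Inductive ty : Type :=
  | ty_unit
  | ty_bool
  | ty_prod (t1 t2 : ty)
  | ty_arrow (t t' : ty).

Section Interpretation.

Variable M : cbpv_model.
Local Notation C := (model_cat M).
Local Notation T := (model_monad M).

Fixpoint cbv (t : ty) : C :=
  match t with
  | ty_unit => one
  | ty_bool => cop_ob (two M)
  | ty_prod t1 t2 => cbv t1 × cbv t2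
  | ty_arrow t t' => cbv t ⇒ T (cbv t')
  end.

Fixpoint cbn (t : ty) : algebra T :=
  match t with
  | ty_unit => free_algebra T one
  | ty_bool => free_algebra T (cop_ob (two M))
  | ty_prod t1 t2 => prod_algebra (cbn t1) (cbn t2)
  | ty_arrow t t' => power_algebra (carrier (cbn t)) (cbn t')
  end.

(* [rel (t := t) fv fn] relates fv and fn at type t and context W; W is implicit
   in the types of fv and fn. *)
Fixpoint rel (t : ty) :
  forall W : C, (W ~> T (cbv t)) -> (W ~> carrier (cbn t)) -> Prop :=
  match t with
  | ty_unit => fun W fv fn => fv ⊑ fn
  | ty_bool => fun W fv fn => fv ⊑ fn
  | ty_prod t1 t2 => fun W fv fn =>
      rel (t := t1) (T_map pi1 ∘ fv) (pi1 ∘ fn) /\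
      rel (t := t2) (T_map pi2 ∘ fv) (pi2 ∘ fn)
  | ty_arrow t t' => fun W fv fn =>
      forall (W' : C) (w : W' ~> W)
             (gv : W' ~> T (cbv t)) (gn : W' ~> carrier (cbn t)),
        rel gv gn ->
        rel (t := t') (dagger ev ∘ ⟪fv ∘ w, gv⟫) (ev ∘ ⟨fn ∘ w, gn⟩)
  end.

Fixpoint phi (t : ty) : T (cbv t) ~> carrier (cbn t) :=
  match t with
  | ty_unit => idm (T one)
  | ty_bool => idm (T (cop_ob (two M)))
  | ty_prod t1 t2 => ⟨phi t1 ∘ T_map pi1, phi t2 ∘ T_map pi2⟩
  | ty_arrow t t' => curry (phi t' ∘ dagger ev ∘ ⟪pi1, psi t ∘ pi2⟫)
  end
with psi (t : ty) : carrier (cbn t) ~> T (cbv t) :=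
  match t with
  | ty_unit => idm (T one)
  | ty_bool => idm (T (cop_ob (two M)))
  | ty_prod t1 t2 => ⟪psi t1 ∘ pi1, psi t2 ∘ pi2⟫
  | ty_arrow t t' =>
      T_eta (cbv (ty_arrow t t')) ∘
      curry (psi t' ∘ ev ∘ (idm _ ⊗ (phi t ∘ T_eta (cbv t))))
  end.

End Interpretation.

(* Main.v *)
(** Lax idempotence makes the Kleisli extension of [k] the least morphism
    restricting to [k] along the unit, because
    [f = f† ∘ (id ⊗ η) ⊒ f† ∘ (id ⊗ Tη) = (f ∘ (id ⊗ η))†] for every
    [f : W × T X ~> T Y]. Three facts follow by comparing extensions with their
    competitors: [⟨T π1, T π2⟩] is left adjoint to [seqL]; a map in two
    computations dominates the extension of its restriction to values; and
    [η ∘ k] is above the identity as soon as [k ∘ η = id], in particular for the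
    canonical [k : T (X ⇒ T Y) ~> X ⇒ T Y]. Both equivalences are then proved
    together by induction on the type, each arrow case instantiating the relation
    at a generic argument: [(ψ ∘ π2, π2)] for φ, and [(η ∘ π2, φ ∘ η ∘ π2)] for ψ. *)

From Stdlib Require Import Relation_Definitions Setoid ssreflect.
Require Import Defs.

Local Open Scope cat_scope.

(** * Order reasoning on hom-sets *)

Section Order.

Context {C : poset_category}.

Lemma hle_refl {X Y : C} (f : X ~> Y) : f ⊑ f.
Proof. exact: (ord_refl _ _ (hle_order _ _)). Qed.

Lemma hle_trans {X Y : C} (g f h : X ~> Y) : f ⊑ g -> g ⊑ h -> f ⊑ h.
Proof. exact: (ord_trans _ _ (hle_order _ _)). Qed.

Lemma comp_monol {X Y Z : C} (g g' : Y ~> Z) (f : X ~> Y) :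
  g ⊑ g' -> g ∘ f ⊑ g' ∘ f.
Proof. by move=> le_g; apply: comp_mono => //; exact: hle_refl. Qed.

Lemma comp_monor {X Y Z : C} (g : Y ~> Z) (f f' : X ~> Y) :
  f ⊑ f' -> g ∘ f ⊑ g ∘ f'.
Proof. by move=> le_f; apply: comp_mono => //; exact: hle_refl. Qed.

End Order.

Lemma pair_le {C : cartesian_category} {W X Y : C} (h : W ~> X × Y)
    (f : W ~> X) (g : W ~> Y) :
  h ⊑ ⟨f, g⟩ <-> pi1 ∘ h ⊑ f /\ pi2 ∘ h ⊑ g.
Proof.
split=> [le_h | [le1 le2]]; last by rewrite -(pair_eta h); apply: pair_mono.
by split; [rewrite -(pi1_pair f g) | rewrite -(pi2_pair f g)]; apply: comp_monor.
Qed.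

Lemma curry_le {C : cartesian_closed_category} {W X Y : C} (f : W × X ~> Y)
    (g : W ~> X ⇒ Y) :
  curry f ⊑ g <-> f ⊑ uncurry g.
Proof.
split=> le_fg; first by rewrite -(curryK f); apply: uncurry_mono.
by rewrite -(uncurryK g); apply: curry_mono.
Qed.

(** * Calculus of Kleisli extensions and sequencing *)

Section Extension.

Context {C : cartesian_category} {T : strong_monad C}.

Lemma dagger_eta {X Y : C} (f : X ~> T Y) : dagger f ∘ T_eta X = f.
Proof.
have -> : dagger f ∘ T_eta X =
    T_ext (f ∘ pi2) ∘ (idm one ⊗ T_eta X) ∘ ⟨bang X, idm X⟩.
  by rewrite /dagger; cartesian; rewrite (bang_unique (bang (T X) ∘ T_eta X)).
by rewrite T_ext_unitl; cartesian.
Qed.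

Lemma dagger_id {X : C} : dagger (T_eta (T := T) X) = idm (T X).
Proof. by rewrite /dagger T_ext_unitr pi2_pair. Qed.

Lemma T_map_eta {X Y : C} (f : X ~> Y) : T_map (T := T) f ∘ T_eta X = T_eta Y ∘ f.
Proof. exact: dagger_eta. Qed.

(** Associativity with the inner parameter object equal to 1, transported along [i], the canonical
    isomorphism that inserts the factor 1. *)
Lemma T_ext_comp_dagger {W X Y Z : C} (f : X ~> T Y) (g : W × Y ~> T Z) :
  T_ext g ∘ (idm W ⊗ dagger f) = T_ext (T_ext g ∘ (idm W ⊗ f)).
Proof.
set i : W × T X ~> (W × one) × T X := ⟨⟨pi1, bang _⟩, pi2⟩.
have /(f_equal (fun h => h ∘ i)) :=
  T_ext_assoc (f ∘ (pi2 : one × X ~> X)) g.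
have -> : T_ext g ∘ (idm W ⊗ (f ∘ pi2)) ∘ assoc =
    T_ext g ∘ (idm W ⊗ f) ∘ ((pi1 : W × one ~> W) ⊗ idm X) by cartesian.
rewrite -T_ext_nat /i /dagger => e.
transitivity (T_ext g ∘ (idm W ⊗ T_ext (f ∘ (pi2 : one × X ~> X))) ∘ assoc ∘ i).
  by rewrite /i; cartesian; rewrite (bang_unique (bang (T X) ∘ pi2)).
by rewrite /i -e; cartesian.
Qed.

(** Associativity again, now with the outer parameter object equal to 1. *)
Lemma dagger_T_ext {W X Y Z : C} (f : W × X ~> T Y) (g : Y ~> T Z) :
  dagger g ∘ T_ext f = T_ext (dagger g ∘ f).
Proof.
have -> : dagger g ∘ f =
    T_ext (g ∘ (pi2 : one × Y ~> Y)) ∘ (idm one ⊗ f) ∘ assoc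
      ∘ (⟨bang W, idm W⟩ ⊗ idm X).
  by rewrite /dagger; cartesian;
    rewrite (bang_unique (bang (T Y) ∘ f)) (bang_unique (bang W ∘ pi1)).
rewrite -T_ext_nat T_ext_assoc /dagger; cartesian.
by rewrite (bang_unique (bang (T Y) ∘ T_ext f)) (bang_unique (bang W ∘ pi1)).
Qed.

Lemma T_ext_right_mono {W X Y : C} (f f' : X × W ~> T Y) :
  f ⊑ f' -> T_ext_right f ⊑ T_ext_right f'.
Proof.
by move=> le_f; apply: comp_monol; apply: T_ext_mono; apply: comp_monol.
Qed.

Lemma dagger_T_ext_right {W X Y Z : C} (f : X × W ~> T Y) (g : Y ~> T Z) :
  dagger g ∘ T_ext_right f = T_ext_right (dagger g ∘ f).
Proof. by rewrite /T_ext_right -comp_assoc dagger_T_ext comp_assoc. Qed.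

Lemma T_ext_right_eta {W X Y : C} (f : X × W ~> T Y) :
  T_ext_right f ∘ (T_eta X ⊗ idm W) = f.
Proof.
have -> : T_ext_right f ∘ (T_eta X ⊗ idm W) =
    T_ext (f ∘ swap) ∘ (idm W ⊗ T_eta X) ∘ swap.
  by rewrite /T_ext_right; cartesian.
by rewrite T_ext_unitl; cartesian.
Qed.

Lemma seq_pair_comp {V W X Y : C} (f : W ~> T X) (g : W ~> T Y) (h : V ~> W) :
  ⟪f, g⟫ ∘ h = ⟪f ∘ h, g ∘ h⟫.
Proof. by rewrite /seq_pair comp_assoc pair_comp. Qed.

Lemma seq_pair_mono {W X Y : C} (f f' : W ~> T X) (g g' : W ~> T Y) :
  f ⊑ f' -> g ⊑ g' -> ⟪f, g⟫ ⊑ ⟪f', g'⟫.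
Proof. by move=> le_f le_g; apply: comp_monor; apply: pair_mono. Qed.

(** A returned value in first position cancels the outer extension of [seqL]; only the one over the
    second computation remains. *)
Lemma seq_pair_eta {W X Y : C} (f : W ~> X) (g : W ~> T Y) :
  ⟪T_eta X ∘ f, g⟫ = T_ext (T_eta (X × Y)) ∘ ⟨f, g⟩.
Proof.
rewrite -(T_ext_right_eta (T_ext (T_eta (X × Y)))).
by rewrite /seq_pair /seqL; cartesian.
Qed.

Lemma seq_pair_eta_eta {W X Y : C} (f : W ~> X) (g : W ~> Y) :
  ⟪T_eta (T := T) X ∘ f, T_eta Y ∘ g⟫ = T_eta (X × Y) ∘ ⟨f, g⟩.
Proof.
by rewrite seq_pair_eta -[in RHS](T_ext_unitl (T_eta (X × Y))); cartesian.
Qed.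

End Extension.

(** * Consequences of lax idempotence *)

Section LaxIdempotent.

Context {C : cartesian_category} {T : strong_monad C}.
Hypothesis lax : lax_idempotent T.

Lemma T_ext_least {W X Y : C} (k : W × X ~> T Y) (f : W × T X ~> T Y) :
  f ∘ (idm W ⊗ T_eta X) = k -> T_ext k ⊑ f.
Proof.
move=> <-.
have -> : T_ext (f ∘ (idm W ⊗ T_eta X)) =
    T_ext f ∘ (idm W ⊗ T_map (T_eta X)).
  rewrite /T_map T_ext_comp_dagger -[in LHS](T_ext_unitl f).
  by congr T_ext; cartesian.
rewrite -[X in _ ⊑ X]T_ext_unitl.
apply: comp_monor; apply: pair_mono; first exact: hle_refl.
by apply: comp_monol; exact: lax.
Qed.

Lemma T_ext_right_least {W X Y : C} (k : X × W ~> T Y) (f : T X × W ~> T Y) :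
  f ∘ (T_eta X ⊗ idm W) = k -> T_ext_right k ⊑ f.
Proof.
move=> <-; have -> : f = f ∘ swap ∘ swap by cartesian.
by apply: comp_monol; apply: T_ext_least; cartesian.
Qed.

(** By the right unit law the identity is itself the extension of the unit, so minimality applies to
    it. *)
Lemma id_le {X : C} (f : T X ~> T X) : f ∘ T_eta X = T_eta X -> idm (T X) ⊑ f.
Proof.
move=> f_eta; rewrite -dagger_id /dagger.
have -> : f = f ∘ pi2 ∘ ⟨bang (T X), idm (T X)⟩ by cartesian.
apply: comp_monol; apply: T_ext_least.
by rewrite -[in RHS]f_eta; cartesian.
Qed.

Lemma T_map_seqL1 {X Y : C} : T_map (T := T) pi1 ∘ seqL ⊑ (pi1 : T X × T Y ~> T X).
Proof.
rewrite /T_map /seqL dagger_T_ext_right dagger_T_ext dagger_eta.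
(* The two nested extensions are bounded one at a time: the inner one by the map that discards the
   second computation, then the outer one by [pi1]. *)
apply: (hle_trans (T_ext_right (T_eta X ∘ pi1))).
  by apply: T_ext_right_mono; apply: T_ext_least; cartesian.
by apply: T_ext_right_least; cartesian.
Qed.

Lemma T_map_seqL2 {X Y : C} : T_map (T := T) pi2 ∘ seqL ⊑ (pi2 : T X × T Y ~> T Y).
Proof.
rewrite /T_map /seqL dagger_T_ext_right dagger_T_ext dagger_eta.
apply: (hle_trans (T_ext_right pi2)).
  by apply: T_ext_right_mono; apply: T_ext_least; cartesian.
by apply: T_ext_right_least; cartesian.
Qed.

Lemma le_seq_pair {W X Y : C} (h : W ~> T (X × Y)) (f : W ~> T X) (g : W ~> T Y) :
  h ⊑ ⟪f, g⟫ <-> T_map pi1 ∘ h ⊑ f /\ T_map pi2 ∘ h ⊑ g.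
Proof.
split=> [le_h | [le1 le2]].
  split.
    rewrite -(pi1_pair f g); apply: hle_trans (comp_monol _ _ _ T_map_seqL1).
    by rewrite comp_assoc; apply: comp_monor.
  rewrite -(pi2_pair f g); apply: hle_trans (comp_monol _ _ _ T_map_seqL2).
  by rewrite comp_assoc; apply: comp_monor.
(* Unit of the adjunction: splitting a computation of pairs and sequencing the halves fixes returned
   pairs, so [id_le] applies. *)
apply: (hle_trans (⟪T_map pi1 ∘ h, T_map pi2 ∘ h⟫)); last exact: seq_pair_mono.
rewrite -{1}(comp_idl h) -seq_pair_comp; apply: comp_monol; apply: id_le.
by rewrite seq_pair_comp !T_map_eta seq_pair_eta_eta pair_id comp_idr.
Qed.

End LaxIdempotent.

(** * Applying computations of functions *)

Section Application.

Context {C : cartesian_closed_category} {T : strong_monad C}.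
Hypothesis lax : lax_idempotent T.

Lemma ev_curry {W V X Y : C} (f : W × X ~> Y) (h : V ~> W) (g : V ~> X) :
  ev ∘ ⟨curry f ∘ h, g⟩ = f ∘ ⟨h, g⟩.
Proof.
by rewrite -[f in RHS](curryK f) uncurryE; cartesian.
Qed.

(** Applying the returned function [curry h] to a computation amounts to [T_ext h], which is the
    least map agreeing with [k] on values. *)
Lemma apply_value_le {W X Y : C} (h : W × X ~> T Y) (k : W × T X ~> T Y) :
  k ∘ (idm W ⊗ T_eta X) = h ->
  dagger ev ∘ ⟪T_eta (X ⇒ T Y) ∘ curry h ∘ pi1, pi2⟫ ⊑ k.
Proof.
move=> <-; rewrite comp_assoc seq_pair_eta -comp_assoc dagger_T_ext dagger_eta.
set h' := k ∘ _.
have -> : ⟨curry h' ∘ pi1, pi2⟩ = curry h' ⊗ idm (T X) by cartesian.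
rewrite T_ext_nat /prod_mor ev_curry comp_idl pair_id comp_idr.
exact: T_ext_least.
Qed.

Lemma id_le_eta_apply {X Y : C} :
  idm (T (X ⇒ T Y)) ⊑
    T_eta (X ⇒ T Y) ∘ curry (dagger ev ∘ ⟪pi1, T_eta X ∘ pi2⟫).
Proof.
apply: (id_le lax); rewrite comp_assoc curry_nat comp_assoc seq_pair_comp.
have -> : pi1 ∘ (T_eta (T := T) (X ⇒ T Y) ⊗ idm X) = T_eta (T := T) (X ⇒ T Y) ∘ pi1 by cartesian.
have -> : T_eta (T := T) X ∘ pi2 ∘ (T_eta (T := T) (X ⇒ T Y) ⊗ idm X) = T_eta (T := T) X ∘ pi2 by cartesian.
rewrite seq_pair_eta_eta -comp_assoc dagger_eta pair_id comp_idr.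
by rewrite /ev uncurryK comp_idr.
Qed.

End Application.

(** * The two equivalences, by induction on types *)

Definition adjoint_to_rel {C : cartesian_category} {X Y : C}
    (phi : X ~> Y) (psi : Y ~> X)
    (R : forall W : C, (W ~> X) -> (W ~> Y) -> Prop) : Prop :=
  forall (W : C) (fv : W ~> X) (fn : W ~> Y),
    (phi ∘ fv ⊑ fn <-> R W fv fn) /\ (R W fv fn <-> fv ⊑ psi ∘ fn).

(** The generic arguments live over [W × N] and [W × A], hence the quantification over all contexts
    in [adjoint_to_rel]. *)
Lemma adjoint_to_rel_arrow {C : cartesian_closed_category} {T : strong_monad C}
    (lax : lax_idempotent T) {A B N N' : C}
    (phi : T A ~> N) (psi : N ~> T A) (phi' : T B ~> N') (psi' : N' ~> T B)
    (R : forall W : C, (W ~> T A) -> (W ~> N) -> Prop)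
    (R' : forall W : C, (W ~> T B) -> (W ~> N') -> Prop) :
  adjoint_to_rel phi psi R -> adjoint_to_rel phi' psi' R' ->
  adjoint_to_rel
    (curry (phi' ∘ dagger ev ∘ ⟪pi1, psi ∘ pi2⟫))
    (T_eta (A ⇒ T B) ∘ curry (psi' ∘ ev ∘ (idm _ ⊗ (phi ∘ T_eta A))))
    (fun W fv fn =>
       forall (W' : C) (w : W' ~> W) (gv : W' ~> T A) (gn : W' ~> N),
         R W' gv gn -> R' W' (dagger ev ∘ ⟪fv ∘ w, gv⟫) (ev ∘ ⟨fn ∘ w, gn⟩)).
Proof.
move=> adj adj' W fv fn; split.
  rewrite curry_nat curry_le uncurryE; split=> [le_phi W' w gv gn gr | fr].
    apply/(proj1 (adj' _ _ _)).
    have /(proj2 (adj _ _ _)) le_gv := gr.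
    apply: (hle_trans (phi' ∘ (dagger ev ∘ ⟪fv ∘ w, psi ∘ gn⟫))).
      do 2 apply: comp_monor.
      by apply: seq_pair_mono => //; exact: hle_refl.
    have -> : ev ∘ ⟨fn ∘ w, gn⟩ = ev ∘ (fn ⊗ idm N) ∘ ⟨w, gn⟩ by cartesian.
    apply: hle_trans (comp_monol _ _ _ le_phi).
    by rewrite /seq_pair; cartesian; exact: hle_refl.
  (* [psi ∘ pi2] is the largest computation related to [pi2]. *)
  have gr : R _ (psi ∘ (pi2 : W × N ~> N)) pi2.
    by apply/(proj2 (adj _ _ _)); exact: hle_refl.
  have /(proj1 (adj' _ _ _)) := fr _ pi1 _ _ gr.
  by rewrite /seq_pair; cartesian.
split=> [fr | le_fv W' w gv gn gr].
  (* Dually, this is the least partner of a returned value. *)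
  have gr : R _ (T_eta A ∘ pi2) (phi ∘ T_eta A ∘ (pi2 : W × A ~> A)).
    by apply/(proj1 (adj _ _ _)); rewrite comp_assoc; exact: hle_refl.
  have /(proj2 (adj' _ _ _)) le_psi := fr _ pi1 _ _ gr.
  (* [fv] need not return its function immediately; [id_le_eta_apply] bounds it by a map that does,
     which can be compared under [curry]. *)
  rewrite -[fv]comp_idl.
  apply: (hle_trans _ _ _ (comp_monol _ _ _ (id_le_eta_apply lax))).
  rewrite !(comp_assoc (T_eta _)) !curry_nat.
  apply: comp_monor; apply: curry_mono.
  by move: le_psi; rewrite /seq_pair; cartesian.
apply/(proj2 (adj' _ _ _)).
have /(proj1 (adj _ _ _)) le_gn := gr.
set h := psi' ∘ ev ∘ _ in le_fv.
(* [k] passes the whole argument computation, translated by [phi], to [fn]; on values it agrees with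
   the body of the function bounding [fv]. *)
set k := psi' ∘ ev ∘ (fn ⊗ phi).
apply: (hle_trans (k ∘ ⟨w, gv⟩)); last first.
  rewrite /k; cartesian; do 2 apply: comp_monor.
  by apply: pair_mono => //; exact: hle_refl.
have k_eta : k ∘ (idm W ⊗ T_eta A) = h ∘ (fn ⊗ idm A).
  by rewrite /k /h; cartesian.
apply: (hle_trans _ _ _ _ (comp_monol _ _ ⟨w, gv⟩ (apply_value_le lax _ _ k_eta))).
rewrite (comp_assoc (dagger ev)) seq_pair_comp (comp_assoc _ pi1) pi1_pair pi2_pair.
apply: comp_monor; apply: seq_pair_mono; last exact: hle_refl.
by apply: comp_monol; rewrite -curry_nat -comp_assoc.
Qed.

Theorem lemma5p8 :
  forall (M : cbpv_model) (lax : lax_idempotent (model_monad M))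
    (t : ty) (W : M)
    (fv : W ~> model_monad M (cbv M t)) (fn : W ~> carrier (cbn M t)),
    (phi M t ∘ fv ⊑ fn <-> rel fv fn) /\
    (rel fv fn <-> fv ⊑ psi M t ∘ fn).
Proof.
move=> M lax; elim=> [||t1 IH1 t2 IH2|t IH t' IH'] W /= fv fn.
- by rewrite !comp_idl.
- by rewrite !comp_idl.
- have [phi1 psi1] := IH1 W (T_map pi1 ∘ fv) (pi1 ∘ fn).
  have [phi2 psi2] := IH2 W (T_map pi2 ∘ fv) (pi2 ∘ fn).
  split.
    (* For [phi] the componentwise conditions are glued by ordinary pairing, for [psi] by the
       adjunction with [seqL]. *)
    rewrite -phi1 -phi2 pair_comp -{1}(pair_eta fn) pair_le pi1_pair pi2_pair.
    by rewrite !comp_assoc.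
  by rewrite seq_pair_comp (le_seq_pair lax) psi1 psi2 !comp_assoc.
- exact: (adjoint_to_rel_arrow lax _ _ _ _ _ _ IH IH').
Qed.
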